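(* Let $X\subset\mathbb{P}^{s-1}$ be the algebraic toric set over $K=\mathbb{F}_q$ parameterized by $\nu_1,\dots,\nu_s\in\mathbb{N}^n$, and let $I(X)\subset S=K[t_1,\dots,t_s]$ be its vanishing ideal. Set $k=\lfloor s/2\rfloor$. If $k\geq 2$, then $I(X)$ has a generating set whose elements have degree $\leq k(q-2)$.
   Context: $K=\mathbb{F}_q$ is a finite field with $q>2$ elements and $K^*=K\setminus\{0\}$. $\mathbb{P}^{s-1}$ is the projective space of dimension $s-1$ over $K$ (classes $[\mathbf{x}]$ of nonzero vectors of $K^s$ modulo scalars in $K^*$). For $\nu=(r_1,\dots,r_n)\in\mathbb{N}^n$ and $\mathbf{x}=(x_1,\dots,x_n)\in(K^* )^n$ put $\mathbf{x}^\nu=x_1^{r_1}\cdots x_n^{r_n}$. The algebraic toric set parameterized by $\nu_1,\dots,\nu_s\in\mathbb{N}^n$ is $X=\{[(\mathbf{x}^{\nu_1},\dots,\mathbf{x}^{\nu_s})]:\mathbf{x}\in(K^* )^n\}\subset\mathbb{P}^{s-1}$. $S=K[t_1,\dots,t_s]$ has the standard grading, and the vanishing ideal $I(X)$ is the ideal of $S$ generated by the homogeneous polynomials vanishing on $X$. *)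

(* Defs.v *)
From HB Require Import structures.
From mathcomp Require Import all_boot all_order all_fingroup all_algebra.
From mathcomp Require Import mpoly.

Set Implicit Arguments.
Unset Strict Implicit.
Unset Printing Implicit Defensive.

Import GRing.Theory.
Local Open Scope ring_scope.

(* The point [v] of the projective space is the K^*-orbit of v, as a finite
   set of row vectors; it is a projective point only when v != 0. *)
Definition proj_class (K : finFieldType) (s : nat) (v : 'rV[K]_s) :
  {set 'rV[K]_s} := [set c *: v | c in [set c : K | c != 0]].

Definition proj_space (K : finFieldType) (s : nat) : {set {set 'rV[K]_s}} :=
  [set proj_class v | v in [set v : 'rV[K]_s | v != 0]].

Definition torus (K : finFieldType) (n : nat) : {set 'rV[K]_n} :=
  [set x : 'rV[K]_n | [forall i, x 0 i != 0]].

Definition monomial_value (K : finFieldType) (n : nat) (x : 'rV[K]_n)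
  (m : 'X_{1..n}) : K := \prod_(i < n) x 0 i ^+ m i.

Definition toric_set (K : finFieldType) (n s : nat) (nu : 'I_s -> 'X_{1..n}) :
  {set {set 'rV[K]_s}} :=
  [set proj_class (\row_(j < s) monomial_value x (nu j)) | x in torus K n].

Lemma toric_set_sub_proj_space (K : finFieldType) (n s : nat)
    (nu : 'I_s -> 'X_{1..n}) :
  (0 < s)%N -> toric_set K nu \subset proj_space K s.
Proof.
move=> s_gt0; apply/subsetP => _ /imsetP[x + ->].
rewrite inE => /forallP x_neq0.
apply: imset_f; rewrite inE; apply/eqP => /rowP /(_ (Ordinal s_gt0)).
rewrite !mxE => /eqP/prodf_eq0[i _].
by rewrite expf_eq0 (negPf (x_neq0 i)) andbF.
Qed.

(* A homogeneous polynomial vanishes at one representative of a projective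
   point iff it vanishes at all of them. *)
Definition vanishes_on (K : finFieldType) (s : nat) (X : {set {set 'rV[K]_s}})
  (f : {mpoly K[s]}) : Prop :=
  forall P, P \in X -> forall v, v \in P -> f.@[fun i => v 0 i] = 0.

Definition ideal_generated (R : comNzRingType) (G : R -> Prop) (f : R) : Prop :=
  exists r : seq (R * R),
    (forall p, p \in r -> G p.2) /\ f = \sum_(p <- r) p.1 * p.2.

Definition vanishing_ideal (K : finFieldType) (s : nat)
  (X : {set {set 'rV[K]_s}}) : {mpoly K[s]} -> Prop :=
  ideal_generated (fun f : {mpoly K[s]} =>
    (exists d, f \is d.-homog) /\ vanishes_on X f).

(* The total degree, with the convention that the zero polynomial has
   degree 0. *)
Definition mpoly_degree (K : finFieldType) (s : nat) (f : {mpoly K[s]}) : nat :=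
  (msize f).-1.

(* Main.v *)
(** The monomials of S restrict on the torus (K \ 0)^n to characters with values
    in K, and distinct ones are orthogonal because the order (q-1)^n of the
    torus is nonzero in K. Hence a homogeneous polynomial vanishing on X is a
    combination of binomials t^a - t^b in I(X) with |a| = |b|. If |a| > k(q-2)
    and a, b have disjoint supports, then one of the supports has at most k
    elements, so that some exponent, say b_i, is at least q-1. For a_j > 0,
    replacing t_i^(q-1) by t_j^(q-1) in t^b changes the binomial by a multiple
    of t_j^(q-1) - t_i^(q-1), whose degree is at most k(q-2) as k >= 2; then
    t_j can be cancelled, and one concludes by induction on |a|. *)

Require Import Defs.
From mathcomp Require Import all_boot all_order all_fingroup all_algebra.
From mathcomp Require Import all_field.
From mathcomp Require Import mpoly.
From mathcomp Require Import zify.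

Set Implicit Arguments.
Unset Strict Implicit.
Unset Printing Implicit Defensive.

Import GRing.Theory.
Local Open Scope ring_scope.

(** * Ideals generated by a predicate *)

Lemma ideal_generated_mem (R : comNzRingType) (G : R -> Prop) g :
  G g -> ideal_generated G g.
Proof.
move=> Gg; exists [:: (1, g)]; split=> [p|]; first by rewrite inE => /eqP->.
by rewrite big_seq1 mul1r.
Qed.

Lemma ideal_generated0 (R : comNzRingType) (G : R -> Prop) :
  ideal_generated G 0.
Proof. by exists [::]; rewrite big_nil. Qed.

Lemma ideal_generatedD (R : comNzRingType) (G : R -> Prop) f g :
  ideal_generated G f -> ideal_generated G g -> ideal_generated G (f + g).
Proof.
move=> [r [rG ->]] [t [tG ->]]; exists (r ++ t); rewrite big_cat; split=> // p.
by rewrite mem_cat => /orP[/rG|/tG].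
Qed.

Lemma ideal_generatedM (R : comNzRingType) (G : R -> Prop) h f :
  ideal_generated G f -> ideal_generated G (h * f).
Proof.
move=> [r [rG ->]]; exists [seq (h * p.1, p.2) | p <- r]; split=> [p|].
  by case/mapP=> p' /rG ? ->.
by rewrite big_map mulr_sumr; apply: eq_bigr => p _; rewrite mulrA.
Qed.

Lemma ideal_generatedB (R : comNzRingType) (G : R -> Prop) f g :
  ideal_generated G f -> ideal_generated G g -> ideal_generated G (f - g).
Proof.
by move=> Jf Jg; rewrite -mulN1r; apply/ideal_generatedD/ideal_generatedM.
Qed.

Lemma ideal_generated_le (R : comNzRingType) (G H : R -> Prop) f :
  (forall g, G g -> ideal_generated H g) ->
  ideal_generated G f -> ideal_generated H f.
Proof.
move=> GH [r [rG ->]]; rewrite big_seq_cond.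
apply: big_ind => [||p]; [exact: ideal_generated0 | exact: ideal_generatedD |].
by rewrite andbT => /rG/GH; apply: ideal_generatedM.
Qed.

Lemma mpoly_degree_homog (K : finFieldType) s (f : {mpoly K[s]}) d :
  f \is d.-homog -> (mpoly_degree f <= d)%N.
Proof.
move=> /dhomogP hf; rewrite /mpoly_degree -subn1 leq_subLR add1n msizeE.
by apply/bigmax_leqP_seq => m /hf ->.
Qed.

(** * Finite fields and the order of the torus *)

Lemma expf_card_unit (K : finFieldType) (x : K) : x != 0 -> x ^+ #|K|.-1 = 1.
Proof.
move=> x0; apply: (mulfI x0); rewrite -exprS prednK ?expf_card ?mulr1 //.
by apply/card_gt0P; exists x.
Qed.

(** Translation by 1 permutes [K], so the sum of all elements does not change when 1 is added to
    each of them. *)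
Lemma card_finField_eq0 (K : finFieldType) : #|K|%:R = 0 :> K.
Proof.
have : \sum_(x : K) x = \sum_(x : K) x + #|K|%:R.
  by rewrite [LHS](reindex_inj (addIr 1)) big_split /= sumr_const.
by rewrite -[LHS]addr0 => /addrI.
Qed.

Lemma monomial_valueM (K : finFieldType) n (x y : 'rV[K]_n) m :
  monomial_value (\row_i (x 0 i * y 0 i)) m =
  monomial_value x m * monomial_value y m.
Proof.
rewrite /monomial_value -big_split; apply: eq_bigr => i _.
by rewrite mxE exprMn.
Qed.

Lemma monomial_value_neq0 (K : finFieldType) n (x : 'rV[K]_n) m :
  x \in torus K n -> monomial_value x m != 0.
Proof.
rewrite inE => /forallP x0; apply/prodf_neq0 => i _.
by rewrite expf_neq0 ?x0.
Qed.

(** Points of the torus correspond to functions from ['I_n] to the units of [K], so the order is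
    (q-1)^n; and q-1 equals -1 in [K]. *)
Lemma card_torus_neq0 (K : finFieldType) n : #|torus K n|%:R != 0 :> K.
Proof.
have -> : torus K n = [set \row_i val (g i) | g : {ffun 'I_n -> {unit K}}].
  apply/setP => x; rewrite inE; apply/forallP/imsetP => [x0|[g _ -> i]].
    have xu i : x 0 i \is a GRing.unit by rewrite unitfE x0.
    exists [ffun i => FinRing.Unit (xu i)] => //.
    by apply/rowP => i; rewrite mxE ffunE.
  by rewrite mxE -unitfE; apply: valP.
rewrite card_imset => [|g h /rowP gh]; last first.
  by apply/ffunP => i; apply: val_inj; have := gh i; rewrite !mxE.
rewrite card_ffun -cardsT card_finField_unit natrX expf_neq0 //.
have : (#|K|.-1%:R + 1 : K) = 0.
  rewrite natr1 prednK ?card_finField_eq0 //.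
  by apply/card_gt0P; exists 0.
by move=> e; apply: contra_eq_neq e => ->; rewrite add0r oner_neq0.
Qed.

(** * Evaluating monomials at the points of X *)

Definition toric_point (K : finFieldType) n s (nu : 'I_s -> 'X_{1..n})
  (x : 'rV[K]_n) : 'I_s -> K := fun j => monomial_value x (nu j).

(** This makes each monomial of S a character of the torus under coordinatewise multiplication. *)
Lemma toric_pointM (K : finFieldType) n s (nu : 'I_s -> 'X_{1..n})
    (x y : 'rV[K]_n) m :
  'X_[m].@[toric_point nu (\row_i (x 0 i * y 0 i))] =
  'X_[m].@[toric_point nu x] * 'X_[m].@[toric_point nu y].
Proof.
rewrite !mevalX -big_split; apply: eq_bigr => j _.
by rewrite /toric_point monomial_valueM exprMn.
Qed.

Lemma toric_pointX_neq0 (K : finFieldType) n s (nu : 'I_s -> 'X_{1..n})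
    (x : 'rV[K]_n) m :
  x \in torus K n -> 'X_[m].@[toric_point nu x] != 0.
Proof.
move=> xT; rewrite mevalX; apply/prodf_neq0 => j _.
by rewrite expf_neq0 ?monomial_value_neq0.
Qed.

Lemma toric_set_neq0 (K : finFieldType) n s (nu : 'I_s -> 'X_{1..n}) P v i :
  P \in toric_set K nu -> v \in P -> v 0 i != 0.
Proof.
case/imsetP=> x xT -> /imsetP[c]; rewrite inE => c0 ->.
by rewrite !mxE mulf_neq0 ?monomial_value_neq0.
Qed.

Lemma vanishes_on_toric_point (K : finFieldType) n s
    (nu : 'I_s -> 'X_{1..n}) (f : {mpoly K[s]}) (x : 'rV[K]_n) :
  vanishes_on (toric_set K nu) f -> x \in torus K n ->
  f.@[toric_point nu x] = 0.
Proof.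
move=> fX xT; pose v := \row_j toric_point nu x j.
rewrite -(fX _ (imset_f _ xT) v).
  by apply: meval_eq => j; rewrite mxE.
by apply/imsetP; exists 1; rewrite ?inE ?oner_neq0 ?scale1r.
Qed.

(** A point of X contains all nonzero multiples of its toric representative; a scalar c multiplies
    both monomials by the same power of c, as their degrees agree. *)
Lemma vanishes_on_binomial (K : finFieldType) n s
    (nu : 'I_s -> 'X_{1..n}) (a b : 'X_{1..s}) :
  mdeg a = mdeg b ->
  {in torus K n, forall x,
     'X_[a].@[toric_point nu x] = 'X_[b].@[toric_point nu x] :> K} ->
  vanishes_on (toric_set K nu) ('X_[a] - 'X_[b]).
Proof.
move=> dab ab P /imsetP[x xT ->] v /imsetP[c _ ->].
have ev m : 'X_[m].@[fun i => (c *: \row_j monomial_value x (nu j)) 0 i] =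
            c ^+ mdeg m * 'X_[m].@[toric_point nu x] :> K.
  rewrite !mevalX mdegE expr_sum -big_split; apply: eq_bigr => j _.
  by rewrite !mxE exprMn.
by rewrite mevalB !ev dab ab ?subrr.
Qed.

(** Points of X have no zero coordinate, so a variable can be cancelled without losing vanishing. *)
Lemma vanishes_onXM (K : finFieldType) n s (nu : 'I_s -> 'X_{1..n}) i
    (f : {mpoly K[s]}) :
  vanishes_on (toric_set K nu) ('X_i * f) -> vanishes_on (toric_set K nu) f.
Proof.
move=> fX P PX v vP; have := fX P PX v vP.
rewrite mevalM mevalXU => /eqP; rewrite mulf_eq0.
by rewrite (negPf (toric_set_neq0 i PX vP)) => /eqP.
Qed.

(** * Orthogonality of characters *)

Lemma sum_toric_characters (K : finFieldType) n s (nu : 'I_s -> 'X_{1..n})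
    (a b : 'X_{1..s}) (y : 'rV[K]_n) :
  y \in torus K n ->
  'X_[a].@[toric_point nu y] != 'X_[b].@[toric_point nu y] :> K ->
  \sum_(x in torus K n)
    'X_[a].@[toric_point nu x] / 'X_[b].@[toric_point nu x] = 0 :> K.
Proof.
move=> yT neq; set S := \sum_(x in _) _.
set r := 'X_[a].@[toric_point nu y] / 'X_[b].@[toric_point nu y] : K.
have r_neq1 : r != 1.
  apply: contra_neq neq => r1.
  by rewrite -[LHS](divfK (toric_pointX_neq0 nu b yT)) -/r r1 mul1r.
have y0 i : y 0 i != 0 by move: yT; rewrite inE => /forallP.
(* Reindexing by multiplication by [y] multiplies each term by [r]; since [r] is not 1, the sum must
   be 0. *)
have : S = S * r.
  rewrite {1}/S.
  rewrite (reindex_inj (h := fun x : 'rV_n => \row_i (x 0 i * y 0 i)));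
    last first.
    move=> x z /rowP xz; apply/rowP => i; apply: (mulIf (y0 i)).
    by have := xz i; rewrite !mxE.
  rewrite mulr_suml; apply: eq_big => [x|x _].
    rewrite !inE; apply: eq_forallb => i.
    by rewrite mxE mulf_eq0 (negPf (y0 i)) orbF.
  by rewrite !toric_pointM invfM mulrACA.
move/eqP; rewrite -subr_eq0 -{1}[S]mulr1 -mulrBr mulf_eq0 subr_eq0.
by rewrite [1 == r]eq_sym (negPf r_neq1) orbF => /eqP.
Qed.

(* Otherwise orthogonality of characters would isolate the coefficient of a. *)
Lemma exists_same_character (K : finFieldType) n s (nu : 'I_s -> 'X_{1..n})
    (f : {mpoly K[s]}) a :
  vanishes_on (toric_set K nu) f -> a \in msupp f ->
  exists b, [/\ b \in msupp f, b != a &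
    {in torus K n, forall x,
      'X_[b].@[toric_point nu x] = 'X_[a].@[toric_point nu x] :> K}].
Proof.
move=> fX af.
pose same b := [forall (x | x \in torus K n),
  'X_[b].@[toric_point nu x] == 'X_[a].@[toric_point nu x] :> K].
have [/hasP[b bf /andP[ba /forall_inP sab]]|/hasPn none] :=
    boolP (has (fun b => (b != a) && same b) (msupp f)).
  by exists b; split=> // x /sab/eqP.
have : \sum_(x in torus K n)
    f.@[toric_point nu x] / 'X_[a].@[toric_point nu x] = 0.
  by apply: big1 => x xT; rewrite (vanishes_on_toric_point fX xT) mul0r.
under eq_bigr => x _ do rewrite mevalE mulr_suml.
rewrite exchange_big (bigD1_seq a) ?msupp_uniq //=.
rewrite [X in _ + X]big1_seq ?addr0 => [|b /andP[ba bf]]; last first.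
  have := none b bf; rewrite ba negb_forall_in => /exists_inP[y yT neq].
  under eq_bigr => x _ do rewrite -mevalX -mulrA.
  by rewrite -mulr_sumr (sum_toric_characters yT neq) mulr0.
(* Only the term of [a] is left: [f@_a] times the order of the torus. That order is nonzero in [K],
   so [f@_a] would be 0. *)
under eq_bigr => x xT do rewrite -mevalX mulfK ?toric_pointX_neq0 //.
rewrite sumr_const -mulr_natr => /eqP; rewrite mulf_eq0.
by rewrite (negPf (card_torus_neq0 _ _)) orbF mcoeff_eq0 af.
Qed.

(** * Reducing the degree of binomials *)

Lemma mdeg_disjoint_bound s (a b : 'X_{1..s}) c :
  mdeg a = mdeg b -> (forall i, (a i == 0) || (b i == 0))%N ->
  (forall i, a i <= c)%N -> (forall i, b i <= c)%N ->
  (mdeg a <= s %/ 2 * c)%N.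
Proof.
move=> dab dis ac bc.
have bound (m : 'X_{1..s}) : (forall i, m i <= c)%N ->
    (mdeg m <= #|[pred i | 0 < m i]| * c)%N.
  move=> mc; rewrite mdegE -sum_nat_const [X in (_ <= X)%N]big_mkcond.
  by apply: leq_sum => i _; rewrite inE; case: posnP => // ->.
have cards : (#|[pred i | 0 < a i]| + #|[pred i | 0 < b i]| <= s)%N.
  rewrite -cardUI [X in (_ + X)%N]eq_card0 ?addn0; last first.
    by move=> i; rewrite !inE; case/orP: (dis i) => /eqP ->; rewrite ?andbF.
  by rewrite -[X in (_ <= X)%N]card_ord max_card.
have := bound a ac; have := bound b bc; rewrite -dab.
(* The supports have at most [s] elements together, so the smaller has at most [s %/ 2]; as the
   degrees agree, either support may be used for the bound. *)
have [ab|ab] := leqP #|[pred i | (0 < a i)%N]| #|[pred i | (0 < b i)%N]|.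
  move=> _ /leq_trans; apply; rewrite leq_mul2r; apply/orP; right; lia.
move=> /leq_trans + _; apply; rewrite leq_mul2r; apply/orP; right; lia.
Qed.

(** With [B] = k(q-2) this is the generating set of the theorem; taking all such polynomials avoids
    choosing an explicit list. *)
Definition bounded_vanishing (K : finFieldType) s
    (X : {set {set 'rV[K]_s}}) (B : nat) (g : {mpoly K[s]}) : Prop :=
  [/\ exists d, g \is d.-homog, vanishes_on X g & (mpoly_degree g <= B)%N].

Lemma binomial_homog (K : finFieldType) s (a b : 'X_{1..s}) d :
  mdeg a = d -> mdeg b = d -> 'X_[a] - 'X_[b] \is [in K[s], d.-homog].
Proof. by move=> da db; apply: rpredB; rewrite dhomogX; apply/eqP. Qed.

Lemma binomial_bounded (K : finFieldType) n s (nu : 'I_s -> 'X_{1..n})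
    (B := (s %/ 2 * (#|K| - 2))%N) d (a b : 'X_{1..s}) :
  (2 < #|K|)%N -> (2 <= s %/ 2)%N -> mdeg a = d -> mdeg b = d ->
  vanishes_on (toric_set K nu) ('X_[a] - 'X_[b]) ->
  ideal_generated (bounded_vanishing (toric_set K nu) B) ('X_[a] - 'X_[b]).
Proof.
move=> q_gt2 s_ge4; set J := ideal_generated _.
have low e (g : {mpoly K[s]}) : g \is e.-homog -> (e <= B)%N ->
    vanishes_on (toric_set K nu) g -> J g.
  move=> ge eB gX; apply: ideal_generated_mem; split=> //; first by exists e.
  exact: leq_trans (mpoly_degree_homog ge) eB.
elim: d a b => [|d IHd] a b da db abX.
  by apply: low (binomial_homog K da db) _ _.
have [dB|Bd] := leqP d.+1 B; first by apply: low (binomial_homog K da db) _ _.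
(* A variable dividing both monomials is cancelled, which brings the degree down to [d], where [IHd]
   applies. *)
have common i (a' b' : 'X_{1..s}) : (0 < a' i)%N -> (0 < b' i)%N ->
    mdeg a' = d.+1 -> mdeg b' = d.+1 ->
    vanishes_on (toric_set K nu) ('X_[a'] - 'X_[b']) ->
    J ('X_[a'] - 'X_[b']).
  move=> ai bi.
  have defm (m : 'X_{1..s}) : (0 < m i)%N -> m = (U_(i) + (m - U_(i)))%MM.
    by move=> mi; rewrite addmC submK // lep1mP -lt0n.
  rewrite (defm a' ai) (defm b' bi) !mdegD !mdeg1 !add1n => -[da'] [db'].
  rewrite !mpolyXD -mulrBr => /vanishes_onXM abX'.
  by apply/ideal_generatedM/IHd.
(* An exponent of at least q-1 is moved from [i] to a variable [j] of [a'], so that [common]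
   applies. If [j] is [i], then [p] below is 0 and nothing changes. *)
have trade (a' b' : 'X_{1..s}) i : (#|K| - 2 < b' i)%N -> mdeg a' = d.+1 ->
    mdeg b' = d.+1 -> vanishes_on (toric_set K nu) ('X_[a'] - 'X_[b']) ->
    J ('X_[a'] - 'X_[b']).
  move=> bi da' db' abX'.
  have /existsP[j aj] : [exists j, 0 < a' j]%N.
    apply: contra_eqT da' => /existsPn a0.
    rewrite mdegE big1 // => j _; apply/eqP.
    by rewrite -leqn0 leqNgt a0.
  pose r := (b' - U_(i) *+ #|K|.-1)%MM.
  have defb : b' = (r + U_(i) *+ #|K|.-1)%MM.
    rewrite submK //; apply/mnm_lepP => l; rewrite mulmnE mnm1E.
    by case: eqP => [<-|//]; rewrite mul1n; lia.
  pose p : {mpoly K[s]} := 'X_j ^+ #|K|.-1 - 'X_i ^+ #|K|.-1.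
  have pX : vanishes_on (toric_set K nu) p.
    move=> P PX v vP; rewrite mevalB !rmorphXn /= !mevalXU.
    by rewrite !expf_card_unit ?subrr ?(toric_set_neq0 _ PX vP).
  have Jp : J p.
    (* Since q > 2 and k >= 2, q-1 <= 2(q-2) <= k(q-2). *)
    apply: (low #|K|.-1) => //; last by rewrite /B; nia.
    by rewrite /p !mpolyXn binomial_homog // mdegMn mdeg1 mul1n.
  have -> : 'X_[a'] - 'X_[b'] =
      ('X_[a'] - 'X_[r + U_(j) *+ #|K|.-1]) + 'X_[r] * p.
    by rewrite mulrBr !mpolyXn -!mpolyXD -defb addrA subrK.
  apply: ideal_generatedD; last exact: ideal_generatedM.
  apply: (common j) => //.
  - by rewrite mnmDE mulmnE mnm1E eqxx mul1n; lia.
  - by rewrite -db' defb !mdegD !mdegMn !mdeg1.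
  (* As [p] vanishes on X, the traded monomial takes the same values there as ['X_[b']]. *)
  - move=> P PX v vP; rewrite -(abX' P PX v vP) !mevalB; congr (_ - _).
    have := pX P PX v vP; rewrite defb mevalB !mpolyXD !mevalM -!mpolyXn.
    by move/eqP; rewrite subr_eq0 => /eqP->.
have [/existsP[i /andP[ai bi]]|/existsPn dis] :=
  boolP [exists i, (0 < a i)%N && (0 < b i)%N]; first exact: (common i).
have [/existsP[i bi]|/existsPn bs] := boolP [exists i, #|K| - 2 < b i]%N.
  exact: (trade _ _ i).
have [/existsP[i ai]|/existsPn als] := boolP [exists i, #|K| - 2 < a i]%N.
  rewrite -opprB -mulN1r; apply: ideal_generatedM; apply: (trade _ _ i) => //.
  by move=> P PX v vP; rewrite -opprB mevalN (abX P) ?oppr0.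
(* Now the supports are disjoint and all exponents are at most q-2, which contradicts [Bd]. *)
suff : (mdeg a <= B)%N by rewrite da leqNgt Bd.
apply: (@mdeg_disjoint_bound _ a b) => [|i|i|i]; rewrite ?da ?db //.
- by have := dis i; rewrite negb_and -!leqNgt !leqn0.
- by rewrite leqNgt.
- by rewrite leqNgt.
Qed.

Theorem proposition4p6 (K : finFieldType) (n s : nat)
    (nu : 'I_s -> 'X_{1..n}) :
  (2 < #|K|)%N ->
  (2 <= s %/ 2)%N ->
  exists G : {mpoly K[s]} -> Prop,
    (forall f : {mpoly K[s]},
       ideal_generated G f <-> vanishing_ideal (toric_set K nu) f) /\
    (forall g : {mpoly K[s]},
       G g -> (mpoly_degree g <= (s %/ 2) * (#|K| - 2))%N).
Proof.
move=> q_gt2 s_ge4.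
exists (bounded_vanishing (toric_set K nu) (s %/ 2 * (#|K| - 2))).
split=> [f|g []//]; split; apply: ideal_generated_le => {}f.
  by case=> df fX _; apply: ideal_generated_mem.
case=> -[d fd] fX.
(* Induction on the number of monomials of [f]; the leading one serves below merely as some element
   of the support. *)
have [N] := ubnP (size (msupp f)); elim: N => // N IHN in f fd fX *.
rewrite ltnS => fN.
have [->|f0] := eqVneq f 0; first exact: ideal_generated0.
have af := mlead_supp f0; set a := mlead f in af.
have [b [bf ba ab]] := exists_same_character fX af.
have da := dhomog_mf fd af; have db := dhomog_mf fd bf.
have abX : vanishes_on (toric_set K nu) ('X_[a] - 'X_[b]).
  by apply: vanishes_on_binomial => [|x /ab]; rewrite ?da ?db.
(* Subtracting this multiple of the binomial transfers the coefficient of [a] to [b]. *)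
rewrite -[f](subrK (f@_a *: ('X_[a] - 'X_[b]))).
apply: ideal_generatedD; last first.
  by rewrite -mul_mpolyC; apply/ideal_generatedM/(binomial_bounded (d := d)).
apply: IHN.
- by rewrite rpredB // rpredZ // binomial_homog.
- move=> P PX v vP.
  by rewrite mevalB mevalZ (fX P PX v vP) (abX P PX v vP) mulr0 subr0.
- have f_gt0 : (0 < size (msupp f))%N by case: (msupp f) af.
  apply: leq_trans fN; rewrite -(prednK f_gt0) ltnS -(size_rem af).
  (* No new monomial appears because [b] was already in the support, while [a] disappears. *)
  apply: uniq_leq_size (msupp_uniq _) _ => m.
  rewrite mem_rem_uniq ?msupp_uniq // inE mcoeff_msupp; apply: contraR.
  rewrite mcoeffB mcoeffZ mcoeffB !mcoeffX negb_and negbK.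
  case/orP=> [/eqP->|mf]; first by rewrite eqxx (negPf ba) subr0 mulr1 subrr.
  have neq c : c \in msupp f -> (c == m) = false.
    by move=> cf; apply: contraNF mf => /eqP<-.
  by rewrite !neq // subrr mulr0 subr0 (memN_msupp_eq0 mf).
Qed.
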